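(* Let $m,a,b>0$ be real numbers. If $\beta=1$ and $c=1$, then $\mathcal{GNB\text{-}BE}(m,\beta,a,b,c)$ reduces to the generalized Waring distribution; that is, the probability mass function of $X\sim\mathcal{GNB\text{-}BE}(m,1,a,b,1)$ is $$h_2(x)=\frac{\Gamma(a+b)\,\Gamma(m+b)\,a_{(x)}\,m_{(x)}}{\Gamma(b)\,\Gamma(m+a+b)\,(m+a+b)_{(x)}}\,\frac{1}{x!},\qquad x=0,1,2,\dots$$
   Context: For $r,s>0$, $B(r,s)=\frac{\Gamma(r)\Gamma(s)}{\Gamma(r+s)}$. For $u>0$ and integer $s\ge 0$, $u_{(s)}=\frac{\Gamma(u+s)}{\Gamma(u)}$. For real $y$ and integer $x\ge 0$, $\binom{y}{x}=\frac{y(y-1)\cdots(y-x+1)}{x!}$. The generalized negative binomial distribution $\mathcal{GNB}(m,\beta,\theta)$ has probability mass function $\frac{m}{m+\beta x}\binom{m+\beta x}{x}(1-\theta)^{x}\theta^{m+\beta x-x}$, $x=0,1,2,\dots$. The beta exponential distribution $\mathcal{BE}(a,b,c)$, $a,b,c>0$, has density $g(\lambda;a,b,c)=\frac{c}{B(a,b)}e^{-bc\lambda}(1-e^{-c\lambda})^{a-1}$ for $\lambda>0$. The distribution $\mathcal{GNB\text{-}BE}(m,\beta,a,b,c)$ is the mixture defined by $X\mid\lambda\sim\mathcal{GNB}(m,\beta,\theta=e^{-\lambda})$, $\lambda\sim\mathcal{BE}(a,b,c)$: its mass function is $$p(x)=\int_0^\infty \frac{m}{m+\beta x}\binom{m+\beta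 x}{x}(1-e^{-\lambda})^{x}e^{-\lambda(m+\beta x-x)}\,g(\lambda;a,b,c)\,d\lambda,\qquad x=0,1,2,\dots$$ The generalized Waring distribution is the distribution with the mass function $h_2$ displayed in the claim. *)

(* Defs.v *)
From mathcomp Require Import all_boot all_order all_algebra.
From mathcomp Require Import all_classical all_reals all_analysis.

Set Implicit Arguments.
Unset Strict Implicit.
Unset Printing Implicit Defensive.

Import Order.TTheory GRing.Theory Num.Theory.
Import numFieldNormedType.Exports.

Local Open Scope classical_set_scope.
Local Open Scope ring_scope.

(* Euler's integral; it converges for 0 < u, the only case in use
   (Rintegral would return a meaningless value otherwise). *)
Definition Gamma {R : realType} (u : R) : R :=
  \int[@lebesgue_measure R]_(t in `]0, +oo[) (t `^ (u - 1) * expR (- t)).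

(* The library's beta_fun only takes natural number arguments. *)
Definition Beta {R : realType} (r s : R) : R :=
  Gamma r * Gamma s / Gamma (r + s).

(* u_(s) *)
Definition rising {R : realType} (u : R) (s : nat) : R :=
  Gamma (u + s%:R) / Gamma u.

(* y choose x, for real y *)
Definition gbinom {R : realType} (y : R) (x : nat) : R :=
  (\prod_(i < x) (y - i%:R)) / x`!%:R.

Definition gnb_pmf {R : realType} (m beta theta : R) (x : nat) : R :=
  m / (m + beta * x%:R) * gbinom (m + beta * x%:R) x
  * (1 - theta) ^+ x * theta `^ (m + beta * x%:R - x%:R).

Definition be_pdf {R : realType} (a b c : R) : R -> R :=
  (fun l : R => c / Beta a b * expR (- (b * c * l))
            * (1 - expR (- (c * l))) `^ (a - 1)) \_ `]0, +oo[.

(* The mixture over l of GNB(m, beta, e^-l); extended-real-valued, so that an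
   equality with a real number includes the convergence of the integral. *)
Definition gnbbe_pmf {R : realType} (m beta a b c : R) (x : nat) : \bar R :=
  (\int[@lebesgue_measure R]_(l in `]0%R, +oo[)
     (gnb_pmf m beta (expR (- l)) x * be_pdf a b c l)%:E)%E.

Definition waring_pmf {R : realType} (m a b : R) (x : nat) : R :=
  Gamma (a + b) * Gamma (m + b) * rising a x * rising m x
  / (Gamma b * Gamma (m + a + b) * rising (m + a + b) x)
  * (1 / x`!%:R).

(* Main.v *)
Require Import Defs.
From mathcomp Require Import all_boot all_order all_algebra.
From mathcomp Require Import all_classical all_reals all_analysis.
From mathcomp Require Import measurable_realfun.
From mathcomp Require Import ring.

(** For beta = 1 the weight m / (m + x) * binom(m + x, x) is m_(x) / x! and the
    power of theta is e^(- l m), so the mixing integral is a constant times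
      I(p, q) = int_0^oo e^(- q l) (1 - e^(- l))^(p - 1) dl
    with p = a + x and q = m + b.  This is Euler's beta integral in the variable
    e^(- l), so I(p, q) = B(p, q), and the Waring mass function follows by
    cancelling values of Gamma.

    The work is in the beta integral.  All integrands are nonnegative, so the
    product formula Gamma(p) Gamma(q) = Gamma(p + q) I(p, q), lemma [eGammaM],
    is proved for extended-real integrals and arbitrary real p and q, before
    anything is known about convergence: in
      Gamma(p) Gamma(q) = int_t t^(q-1) e^(-t) (int_s s^(p-1) e^(-s) ds) dt
    substitute s = t (e^l - 1) for fixed t, exchange the integrals by Tonelli,
    and rescale t by e^l for fixed l; the t-integral becomes Gamma(p + q) and
    the factor left over is the integrand of I(p, q).

    The basic theory of Gamma is then a consequence of this one identity.
    At p = 1, where Gamma(1) = 1 and I(1, q) = 1 / q, it is the functional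
    equation [eGammaD1]; that gives finiteness at positive integers, hence at
    every u > 1 by comparison of powers, hence at every u > 0 ([eGamma_lty]). *)

Set Implicit Arguments.
Unset Strict Implicit.
Unset Printing Implicit Defensive.

Import Order.TTheory GRing.Theory Num.Theory.
Import numFieldNormedType.Exports.
Local Open Scope classical_set_scope.
Local Open Scope ring_scope.

(** * Integration over the positive half-line *)

Lemma bigcup_exhaustion_pos (R : realType) (F : R -> R)
    (F_gt0 : forall x : R, 0 < x -> 0 < F x)
    (F_incr : {homo F : x y / x < y})
    (F_surj : forall y : R, 0 < y -> exists2 x : R, 0 < x & F x = y) :
  \bigcup_n `[F n.+1%:R^-1, F n.+1%:R]%classic = `]0, +oo[%classic.
Proof.
have F_le : {homo F : x y / x <= y} by apply: ltW_homo.
apply/seteqP; split => y /=.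
  move=> [n _] /=; rewrite !in_itv/= andbT => /andP[+ _].
  by apply: lt_le_trans; apply: F_gt0; rewrite invr_gt0.
rewrite in_itv/= andbT => /F_surj[x x0 <-].
exists (maxn (Num.truncn x) (Num.truncn x^-1)) => //=; rewrite in_itv/=.
apply/andP; split; apply: F_le; last first.
  by rewrite (le_trans (ltW (Num.Theory.truncnS_gt _)))// ler_nat ltnS leq_maxl.
rewrite invf_ple ?posrE//.
by rewrite (le_trans (ltW (Num.Theory.truncnS_gt _)))// ler_nat ltnS leq_maxr.
Qed.

(** F bounds the intervals so that the same statement serves both sides of a
    substitution: with F = id it exhausts the half-line by [1/n, n], and with
    the substituting function by the images of these intervals. *)
Lemma cvg_integral_exhaustion (R : realType) (F G : R -> R)
    (F_gt0 : forall x : R, 0 < x -> 0 < F x)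
    (F_incr : {homo F : x y / x < y})
    (F_surj : forall y : R, 0 < y -> exists2 x : R, 0 < x & F x = y)
    (mG : measurable_fun `](0 : R), +oo[ G)
    (G_ge0 : forall y : R, 0 < y -> 0 <= G y) :
  (\int[@lebesgue_measure R]_(y in `[F n.+1%:R^-1%R, F n.+1%:R%R]) (G y)%:E
    @[n --> \oo] --> \int[@lebesgue_measure R]_(y in `]0%R, +oo[) (G y)%:E)%E.
Proof.
have F_le : {homo F : x y / x <= y} by apply: ltW_homo.
have sub n : `[F n.+1%:R^-1, F n.+1%:R]%classic `<=` `]0, +oo[%classic.
  rewrite -(bigcup_exhaustion_pos F_gt0 F_incr F_surj).
  exact: (@bigcup_sup _ _ n).
rewrite -(bigcup_exhaustion_pos F_gt0 F_incr F_surj).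
apply: (@ge0_nondecreasing_set_cvg_integral _ (measurableTypeR R) _
  (fun n => `[F n.+1%:R^-1, F n.+1%:R]%classic) (EFin \o G)) => //.
- move=> m n mn; apply/subsetPset => y /=; rewrite !in_itv/= => /andP[a b].
  apply/andP; split; [apply: le_trans a|apply: (le_trans b)]; apply: F_le.
    by rewrite lef_pV2 ?posrE// ler_nat.
  by rewrite ler_nat.
- by move=> n; apply/measurable_EFinP; exact: measurable_funS mG.
- by move=> n y /sub/=; rewrite in_itv/= andbT => y0; rewrite lee_fin G_ge0.
Qed.

(** Applying substitution on the compact intervals [1/n, n] and passing to the
    limit on both sides means that G may be singular at 0 (as t^(u-1) is for
    u < 1) and the derivative of F unbounded at infinity (as it is for
    t (e^l - 1)). *)
Lemma integration_by_substitution_pos (R : realType) (F f G : R -> R)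
    (F_gt0 : forall x : R, 0 < x -> 0 < F x)
    (F_incr : {homo F : x y / x < y})
    (F_surj : forall y : R, 0 < y -> exists2 x : R, 0 < x & F x = y)
    (dF : forall x : R, is_derive x 1 F (f x))
    (cf : continuous f)
    (cG : forall y : R, 0 < y -> {for y, continuous G})
    (G_ge0 : forall y : R, 0 < y -> 0 <= G y) :
  (\int[@lebesgue_measure R]_(y in `]0%R, +oo[) (G y)%:E =
   \int[@lebesgue_measure R]_(x in `]0%R, +oo[) (G (F x) * f x)%R%:E)%E.
Proof.
have fE : derive1 F = f by apply/funext => x; rewrite derive1E derive_val.
have derF (x : R) : derivable F x 1 by exact: ex_derive.
have cF : continuous F.
  by move=> x; exact/differentiable_continuous/derivable1_diffP.
have f_ge0 x : 0 <= f x.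
  rewrite -fE; apply: (@incr_derive1_ge0 _ _ setT) => //.
  - by move=> ? ? _ _; exact: F_incr.
  - by rewrite interiorT.
have mG : measurable_fun `](0 : R), +oo[ G.
  apply: open_continuous_measurable_fun; first exact: interval_open.
  by move=> y; rewrite inE/= in_itv/= andbT; exact: cG.
have mGF : measurable_fun `](0 : R), +oo[ (fun x => G (F x) * f x).
  apply: open_continuous_measurable_fun; first exact: interval_open.
  move=> x; rewrite inE/= in_itv/= andbT => x0.
  have cGF : {for x, continuous (G \o F)}.
    by apply: continuous_comp; [exact: cF|exact: cG (F_gt0 _ x0)].
  exact: (continuousM cGF (cf x)).
have H1 := @cvg_integral_exhaustion R F G F_gt0 F_incr F_surj mG G_ge0.
have H2 := @cvg_integral_exhaustion R id (fun x => G (F x) * f x)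
  (fun x => id) (fun x y => id) (fun y y0 => ex_intro2 _ _ y y0 erefl) mGF
  (fun x x0 => mulr_ge0 (G_ge0 _ (F_gt0 _ x0)) (f_ge0 x)).
apply: (cvg_unique (@ereal_hausdorff R) H1).
apply: cvg_trans H2; apply: near_eq_cvg.
apply: nearW => n /=.
have n1 : n.+1%:R^-1 <= n.+1%:R :> R.
  by rewrite (@le_trans _ _ 1)// ?invf_le1 ?ler1n.
rewrite (integration_by_substitution_increasing (F := F) (G := G) n1)//.
- by rewrite fE.
- by move=> x y _ _; exact: F_incr.
- by rewrite fE => x _; exact: cf.
- rewrite fE; apply/cvg_ex; exists (f n.+1%:R^-1).
  by apply: cvg_at_right_filter; exact: cf.
- rewrite fE; apply/cvg_ex; exists (f n.+1%:R).
  by apply: cvg_at_left_filter; exact: cf.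
- split => //; first by apply: cvg_at_right_filter; exact: cF.
  by apply: cvg_at_left_filter; exact: cF.
- apply: continuous_in_subspaceT => y; rewrite inE/= in_itv/= => /andP[ay _].
  by apply: cG; apply: lt_le_trans ay; rewrite F_gt0.
Qed.

(** Extending h by zero outside the positive quadrant reduces this to Tonelli's
    theorem on the plane. *)
Lemma tonelli_pos (R : realType) (h : R * R -> R)
    (mh : measurable_fun [set: R * R] h)
    (h_ge0 : forall x y : R, 0 < x -> 0 < y -> 0 <= h (x, y)) :
  (\int[@lebesgue_measure R]_(x in `]0%R, +oo[)
     \int[@lebesgue_measure R]_(y in `]0%R, +oo[) (h (x, y))%:E =
   \int[@lebesgue_measure R]_(y in `]0%R, +oo[)
     \int[@lebesgue_measure R]_(x in `]0%R, +oo[) (h (x, y))%:E)%E.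
Proof.
pose D : set R := `]0, +oo[%classic.
pose g := (EFin \o h) \_ (D `*` D).
have mg : measurable_fun setT g.
  apply/(measurable_restrictT (EFin \o h)).
    by apply: measurableX; exact: measurable_itv.
  by apply/measurable_EFinP; exact: measurable_funTS mh.
have g0 z : (0 <= g z)%E.
  rewrite /g patchE; case: ifPn => // /[!inE]; case: z => x y [] /=.
  by rewrite /D/= !in_itv/= !andbT lee_fin; exact: h_ge0.
have Hf := fubini_tonelli (m1 := @lebesgue_measure R) (m2 := @lebesgue_measure R)
  g mg g0.
rewrite [LHS]integral_mkcond [RHS]integral_mkcond.
transitivity (\int[@lebesgue_measure R]_x
    \int[@lebesgue_measure R]_y g (x, y))%E; [|rewrite Hf];
  apply: eq_integral => x _; rewrite patchE; case: ifPn => xD.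
- rewrite integral_mkcond; apply: eq_integral => y _.
  by rewrite /g !patchE in_setX/= xD.
- rewrite integral0_eq// => y _.
  by rewrite /g !patchE in_setX/= (negbTE xD).
- rewrite [RHS]integral_mkcond; apply: eq_integral => y _.
  by rewrite /g !patchE in_setX/= xD andbT.
- rewrite integral0_eq// => y _.
  by rewrite /g !patchE in_setX/= (negbTE xD) andbF.
Qed.

(** * The Gamma and beta integrals with values in the extended reals *)

(** Extended-real-valued, so that identities between integrals of nonnegative
    functions make sense before convergence is established. *)
Definition eGamma {R : realType} (u : R) : \bar R :=
  (\int[@lebesgue_measure R]_(t in `]0%R, +oo[)
    (t `^ (u - 1) * expR (- t))%R%:E)%E.

(** Euler's beta integral int_0^1 v^(q-1) (1-v)^(p-1) dv after v = e^(-l). *)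
Definition eBeta_exp {R : realType} (p q : R) : \bar R :=
  (\int[@lebesgue_measure R]_(l in `]0%R, +oo[)
    (expR (- (q * l)) * (1 - expR (- l)) `^ (p - 1))%R%:E)%E.

Lemma GammaE (R : realType) (u : R) : Gamma u = fine (eGamma u).
Proof. by []. Qed.

Lemma eGamma_ge0 (R : realType) (u : R) : (0 <= eGamma u)%E.
Proof.
by apply: integral_ge0 => t _; rewrite lee_fin mulr_ge0 ?powR_ge0 ?expR_ge0.
Qed.

Lemma eBeta_exp_ge0 (R : realType) (p q : R) : (0 <= eBeta_exp p q)%E.
Proof.
by apply: integral_ge0 => t _; rewrite lee_fin mulr_ge0 ?powR_ge0 ?expR_ge0.
Qed.

Lemma continuous_Gamma_integrand (R : realType) (u t : R) : 0 < t ->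
  {for t, continuous (fun t => t `^ (u - 1) * expR (- t))}.
Proof.
move=> t0.
have c1 : {for t, continuous (fun t : R => t `^ (u - 1))}.
  apply/differentiable_continuous/derivable1_diffP.
  by apply: derivable_powR; rewrite in_itv/= andbT.
have c2 : {for t, continuous (fun t : R => expR (- t))}.
  apply: (@continuous_comp _ _ _ -%R expR); first exact: continuousN.
  exact: continuous_expR.
exact: (continuousM c1 c2).
Qed.

Lemma measurable_Gamma_integrand (R : realType) (u : R) :
  measurable_fun [set: R] (fun t => t `^ (u - 1) * expR (- t)).
Proof.
apply: measurable_funM; first exact: measurable_powR.
by apply: measurableT_comp => //; exact: measurable_expR.
Qed.

Lemma measurable_eBeta_exp_integrand (R : realType) (p q : R) :
  measurable_fun [set: R]
    (fun l => expR (- (q * l)) * (1 - expR (- l)) `^ (p - 1)).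
Proof.
apply: measurable_funM.
  apply: measurableT_comp; first exact: measurable_expR.
  by apply: measurableT_comp => //; exact: measurable_funM.
apply: (measurableT_comp (measurable_powR _)).
apply: measurable_funB => //.
by apply: measurableT_comp => //; exact: measurable_expR.
Qed.

(** * The product formula *)

Lemma eGamma_scale (R : realType) (u c : R) : 0 < c ->
  eGamma u = (\int[@lebesgue_measure R]_(t in `]0%R, +oo[)
    ((c * t) `^ (u - 1) * expR (- (c * t)) * c)%R%:E)%E.
Proof.
move=> c0; apply: (@integration_by_substitution_pos R (fun t => c * t)
  (fun=> c) (fun t => t `^ (u - 1) * expR (- t))).
- by move=> x x0; rewrite mulr_gt0.
- by move=> x y xy; rewrite ltr_pM2l.
- move=> y y0; exists (y / c); first by rewrite divr_gt0.
  by rewrite mulrCA divff ?mulr1// gt_eqF.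
- move=> x; apply: is_derive_eq; by rewrite /GRing.scale/= mulr1.
- exact: cst_continuous.
- by move=> y; exact: continuous_Gamma_integrand.
- by move=> y _; rewrite mulr_ge0 ?powR_ge0 ?expR_ge0.
Qed.

(** The substitution s = t (e^l - 1) makes e^(-t) e^(-s) equal to e^(-t e^l),
    which separates the double integral once t is rescaled. *)
Lemma eGamma_expR (R : realType) (p t : R) : 0 < t ->
  eGamma p = (\int[@lebesgue_measure R]_(l in `]0%R, +oo[)
    ((t * (expR l - 1)) `^ (p - 1) * expR (- (t * (expR l - 1)))
      * (t * expR l))%R%:E)%E.
Proof.
move=> t0; apply: (@integration_by_substitution_pos R
  (fun l => t * (expR l - 1)) (fun l => t * expR l)
  (fun t => t `^ (p - 1) * expR (- t))).
- by move=> x x0; rewrite mulr_gt0// subr_gt0 expR_gt1.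
- by move=> x y xy; rewrite ltr_pM2l// ltrD2r ltr_expR.
- move=> y y0; exists (ln (1 + y / t)).
    by rewrite ln_gt0// ltrDl divr_gt0.
  rewrite lnK ?posrE ?addr_gt0 ?divr_gt0// addrAC subrr add0r.
  by rewrite mulrCA divff ?mulr1// gt_eqF.
- move=> x; apply: is_derive_eq.
  by rewrite subr0 /GRing.scale/=.
- move=> x; apply: continuousM; first exact: cst_continuous.
  exact: continuous_expR.
- by move=> y; exact: continuous_Gamma_integrand.
- by move=> y _; rewrite mulr_ge0 ?powR_ge0 ?expR_ge0.
Qed.

(** On the left the integrand of Gamma(p) Gamma(q) after s = t (e^l - 1); on the
    right the rescaled integrand of Gamma(p + q) times that of the beta
    integral.  It rests on e^l - 1 = e^l (1 - e^(-l)). *)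
Lemma eGammaM_integrand (R : realType) (p q t l : R) : 0 < t -> 0 < l ->
  (t `^ (q - 1) * expR (- t)) *
    ((t * (expR l - 1)) `^ (p - 1) * expR (- (t * (expR l - 1)))
      * (t * expR l)) =
  ((expR l * t) `^ (p + q - 1) * expR (- (expR l * t)) * expR l) *
    (expR (- (q * l)) * (1 - expR (- l)) `^ (p - 1)).
Proof.
move=> t0 l0.
have E0 : 0 < expR l by exact: expR_gt0.
have w0 : 0 < 1 - expR (- l) by rewrite subr_gt0 expR_lt1 oppr_lt0.
have tn : t != 0 by rewrite gt_eqF.
have En : expR l != 0 by rewrite gt_eqF.
have -> : expR (- (expR l * t)) = expR (- t) * expR (- (t * (expR l - 1))).
  by rewrite -expRD; congr expR; ring.
have -> : expR l - 1 = expR l * (1 - expR (- l)).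
  by rewrite mulrBr mulr1 -expRD subrr expR0.
have -> : expR (- (q * l)) = expR l `^ (- q).
  by rewrite /powR gt_eqF// expRK mulNr.
rewrite !powRM ?mulr_ge0 ?(ltW t0) ?(ltW E0) ?(ltW w0)//.
have -> : t `^ (p + q - 1) = t `^ (q - 1) * t `^ (p - 1) * t.
  rewrite -[X in _ = _ * X](powRr1 (ltW t0)) -!powRD ?tn ?implybT//.
  by congr (_ `^ _); ring.
have -> : expR l `^ (p - 1) = expR l `^ (p + q - 1) * expR l `^ (- q).
  rewrite -powRD ?En ?implybT//.
  by congr (_ `^ _); ring.
ring.
Qed.

(** Both sides are the integral of h over the positive quadrant, taken in the
    two orders; they may both be infinite. *)
Lemma eGammaM (R : realType) (p q : R) :
  (eGamma p * eGamma q = eGamma (p + q) * eBeta_exp p q)%E.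
Proof.
pose mu := @lebesgue_measure R.
pose h (z : R * R) := (z.1 `^ (q - 1) * expR (- z.1)) *
    ((z.1 * (expR z.2 - 1)) `^ (p - 1) * expR (- (z.1 * (expR z.2 - 1)))
      * (z.1 * expR z.2)).
have mE2 : measurable_fun [set: R * R] (fun z : R * R => expR z.2).
  by apply: measurableT_comp => //; exact: measurable_expR.
have mhE : measurable_fun [set: R * R] (fun z : R * R => z.1 * (expR z.2 - 1)).
  by apply: measurable_funM => //; exact: measurable_funB.
have mh : measurable_fun [set: R * R] h.
  apply: measurable_funM.
    exact: (measurableT_comp (measurable_Gamma_integrand q)).
  apply: measurable_funM; last exact: measurable_funM.
  exact: (measurableT_comp (measurable_Gamma_integrand p) mhE).
have h0 x y : 0 < x -> 0 < y -> 0 <= h (x, y).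
  move=> x0 y0; rewrite /h/=.
  by rewrite !mulr_ge0 ?powR_ge0 ?expR_ge0// ltW.
transitivity (\int[mu]_(t in `]0%R, +oo[)
    \int[mu]_(l in `]0%R, +oo[) (h (t, l))%:E)%E.
  rewrite muleC [X in (X * _)%E = _]/eGamma -ge0_integralZr//; last first.
  - exact: eGamma_ge0.
  - by move=> t _; rewrite lee_fin mulr_ge0 ?powR_ge0 ?expR_ge0.
  - apply/measurable_EFinP/measurable_funTS.
    exact: measurable_Gamma_integrand.
  apply: eq_integral => t; rewrite inE/= in_itv/= andbT => t0.
  rewrite (eGamma_expR p t0) -ge0_integralZl//.
  - apply/measurable_EFinP/measurable_funTS.
    apply: measurable_funM; last first.
      by apply: measurable_funM => //; exact: measurable_expR.
    apply: (measurableT_comp (measurable_Gamma_integrand p)).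
    by apply: measurable_funM => //; apply: measurable_funB => //;
      exact: measurable_expR.
  - move=> l _; rewrite lee_fin.
    by rewrite !mulr_ge0 ?powR_ge0 ?expR_ge0// ltW.
  - by rewrite lee_fin mulr_ge0 ?powR_ge0 ?expR_ge0.
rewrite tonelli_pos// [in RHS]/eBeta_exp -ge0_integralZl//; last first.
- exact: eGamma_ge0.
- by move=> l _; rewrite lee_fin mulr_ge0 ?powR_ge0 ?expR_ge0.
- apply/measurable_EFinP/measurable_funTS.
  exact: measurable_eBeta_exp_integrand.
apply: eq_integral => l; rewrite inE/= in_itv/= andbT => l0.
rewrite (eGamma_scale (p + q) (expR_gt0 l)) -ge0_integralZr//.
- apply: eq_integral => t; rewrite inE/= in_itv/= andbT => t0.
  by rewrite -EFinM -eGammaM_integrand.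
- apply/measurable_EFinP/measurable_funTS.
  apply: measurable_funM => //.
  apply: (measurableT_comp (measurable_Gamma_integrand (p + q))).
  exact: measurable_funM.
- move=> t _; rewrite lee_fin.
  by rewrite !mulr_ge0 ?powR_ge0 ?expR_ge0.
- by rewrite lee_fin mulr_ge0 ?powR_ge0 ?expR_ge0.
Qed.

(** * Functional equation, finiteness and positivity of Gamma *)

Lemma eGamma1 (R : realType) : eGamma (1 : R) = 1%E.
Proof.
rewrite -(integral_exponential_pdf (ltr01 : 0 < 1 :> R)).
rewrite /eGamma integral_itv_obnd_cbnd; last first.
  apply/measurable_EFinP/measurable_funTS; exact: measurable_Gamma_integrand.
rewrite integral_mkcond; apply: eq_integral => t _.
rewrite /exponential_pdf !patchE; case: ifPn => // _.
by rewrite subrr powRr0 !mul1r mulN1r.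
Qed.

(** For p = 1 the integrand is e^(-q l): the integral of Gamma(1) rescaled. *)
Lemma eBeta_exp1 (R : realType) (q : R) : 0 < q ->
  eBeta_exp 1 q = (q^-1)%:E.
Proof.
move=> q0.
have : (eBeta_exp 1 q * q%:E = 1)%E.
  rewrite -[RHS](@eGamma1 R) (eGamma_scale 1 q0) /eBeta_exp -ge0_integralZr//.
  - by apply: eq_integral => l _; rewrite subrr !powRr0 mulr1 mul1r.
  - apply/measurable_EFinP/measurable_funTS.
    exact: measurable_eBeta_exp_integrand.
  - by move=> l _; rewrite lee_fin mulr_ge0 ?powR_ge0 ?expR_ge0.
  - by rewrite lee_fin ltW.
by move=> H; rewrite -[RHS]mul1e -H -muleA -EFinM divff ?gt_eqF// mule1.
Qed.

(** The product formula at p = 1; it takes the place of integration by parts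
    and holds whether or not the integrals converge. *)
Lemma eGammaD1 (R : realType) (u : R) : 0 < u ->
  (eGamma u = eGamma (u + 1) * (u^-1)%:E)%E.
Proof.
by move=> u0; rewrite -[LHS]mul1e -eGamma1 eGammaM addrC eBeta_exp1.
Qed.

Lemma eGamma_nat_lty (R : realType) (n : nat) :
  (eGamma (n.+1%:R : R) < +oo)%E.
Proof.
elim: n => [|n ih]; first by rewrite eGamma1 ltry.
have n0 : 0 < n.+1%:R :> R by [].
move: ih; rewrite (eGammaD1 n0) -(@natr1 R n.+1).
have := eGamma_ge0 (n.+1%:R + 1 : R).
case: (eGamma _) => [r _ _|_|//]; first by rewrite ltry.
by rewrite mulyr gtr0_sg ?invr_gt0// mul1e.
Qed.

(** The functional equation moves u into the range u + 1 > 1.  There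
    t^u <= 1 + t^(n+1) for an integer n + 1 > u, so Gamma(u + 1) is at most
    Gamma(1) + Gamma(n + 2), which is finite. *)
Lemma eGamma_lty (R : realType) (u : R) : 0 < u -> (eGamma u < +oo)%E.
Proof.
move=> u0.
suff H : (eGamma (u + 1) < +oo)%E.
  rewrite (eGammaD1 u0); apply: lte_mul_pinfty => //.
    exact: eGamma_ge0.
    by rewrite ge0_fin_numE ?eGamma_ge0.
  exact: ltry.
pose n := Num.truncn u.
apply: (@le_lt_trans _ _ (eGamma 1 + eGamma n.+2%:R)%E); last first.
  rewrite eGamma1 lte_add_pinfty ?ltry//; exact: eGamma_nat_lty.
rewrite /eGamma -ge0_integralD//; last first.
- by apply/measurable_EFinP/measurable_funTS; exact: measurable_Gamma_integrand.
- by move=> t _; rewrite lee_fin mulr_ge0 ?powR_ge0 ?expR_ge0.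
- by apply/measurable_EFinP/measurable_funTS; exact: measurable_Gamma_integrand.
- by move=> t _; rewrite lee_fin mulr_ge0 ?powR_ge0 ?expR_ge0.
apply: ge0_le_integral => //.
- by move=> t _; rewrite lee_fin mulr_ge0 ?powR_ge0 ?expR_ge0.
- by apply/measurable_EFinP/measurable_funTS; exact: measurable_Gamma_integrand.
- by apply: emeasurable_funD; apply/measurable_EFinP/measurable_funTS;
    exact: measurable_Gamma_integrand.
move=> t; rewrite /= in_itv/= andbT => t0.
rewrite -EFinD lee_fin -mulrDl ler_wpM2r ?expR_ge0//.
rewrite addrK subrr powRr0.
have [t1|t1] := leP t 1.
  rewrite (@le_trans _ _ 1) ?lerDl ?powR_ge0//.
  by rewrite -[leRHS](powRr0 t) ger_powR ?t0// ltW.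
rewrite (@le_trans _ _ (t `^ (n.+2%:R - 1))) ?lerDr//.
rewrite ler_powR ?(ltW t1)// -(@natr1 R n.+1) addrK ltW//.
exact: Num.Theory.truncnS_gt.
Qed.

(** Were the integral zero, the everywhere positive integrand would vanish
    almost everywhere on the half-line, which has infinite measure. *)
Lemma eGamma_gt0 (R : realType) (u : R) : (0 < eGamma u)%E.
Proof.
rewrite lt0e eGamma_ge0 andbT; apply/eqP => G0.
have : (\int[@lebesgue_measure R]_(t in `]0%R, +oo[)
    `|(t `^ (u - 1) * expR (- t))%R%:E| = 0)%E.
  rewrite -[RHS]G0; apply: eq_integral => t _.
  by rewrite gee0_abs// lee_fin mulr_ge0 ?powR_ge0 ?expR_ge0.
move/ae_eq_integral_abs => H.
have {}H := H (measurable_itv _) _.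
have /H[N [mN N0 sub]] : measurable_fun `](0 : R), +oo[
    (fun t => (t `^ (u - 1) * expR (- t))%R%:E).
  by apply/measurable_EFinP/measurable_funTS; exact: measurable_Gamma_integrand.
have : (@lebesgue_measure R `](0 : R)%R, +oo[ <= 0)%E.
  rewrite -N0; apply: le_measure; rewrite ?inE//.
  move=> t /= t0; apply: sub => /= /(_ t0)/eqP.
  move: t0; rewrite in_itv/= andbT => t0.
  by rewrite eqe gt_eqF// mulr_gt0 ?expR_gt0 ?powR_gt0.
by rewrite lebesgue_measure_itv/= ltry.
Qed.

Lemma Gamma_eGamma (R : realType) (u : R) : 0 < u -> (Gamma u)%:E = eGamma u.
Proof.
by move=> u0; rewrite GammaE fineK// ge0_fin_numE ?eGamma_ge0// eGamma_lty.
Qed.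

Lemma Gamma_gt0 (R : realType) (u : R) : 0 < u -> 0 < Gamma u.
Proof. by move=> u0; rewrite -lte_fin Gamma_eGamma// eGamma_gt0. Qed.

Lemma GammaD1 (R : realType) (u : R) : 0 < u -> Gamma (u + 1) = u * Gamma u.
Proof.
move=> u0; have := eGammaD1 u0.
rewrite -!Gamma_eGamma ?addr_gt0// -EFinM => -[->].
by rewrite mulrCA divff ?mulr1// gt_eqF.
Qed.

(** Division in the product formula; an infinite beta integral is excluded
    because the product of Gamma values is finite and Gamma (p + q) > 0. *)
Lemma eBeta_expE (R : realType) (p q : R) : 0 < p -> 0 < q ->
  eBeta_exp p q = (Beta p q)%:E.
Proof.
move=> p0 q0; have pq0 : 0 < p + q by rewrite addr_gt0.
have := eGammaM p q; rewrite -!Gamma_eGamma// -EFinM.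
have G0 := Gamma_gt0 pq0.
have := eBeta_exp_ge0 p q.
case: (eBeta_exp p q) => [r _|_|//].
  by rewrite /Beta -EFinM => -[->]; rewrite mulrAC divff ?mul1r// gt_eqF.
by rewrite mulry gtr0_sg// mul1e.
Qed.

Lemma rising_prod (R : realType) (u : R) (n : nat) : 0 < u ->
  rising u n = \prod_(i < n) (u + i%:R).
Proof.
move=> u0; have G0 := Gamma_gt0 u0; elim: n => [|n ih].
  by rewrite big_ord0 /rising addr0 divff// gt_eqF.
rewrite big_ord_recr/= -ih /rising -natr1 addrA GammaD1; last first.
  by rewrite ltr_wpDr.
by rewrite -mulrA mulrC.
Qed.

(** * The mixture for beta = 1 and c = 1 *)

(** (m + x) (m + x - 1) ... (m + 1), stripped of its top factor by the
    denominator and completed by m, is the product of the m + i, i < x, read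
    backwards. *)
Lemma gnb_coef1 (R : realType) (m : R) (x : nat) : 0 < m ->
  m / (m + 1 * x%:R) * gbinom (m + 1 * x%:R) x = rising m x / x`!%:R.
Proof.
move=> m0; rewrite mul1r rising_prod// /gbinom mulrA; congr (_ / _).
case: x => [|n]; first by rewrite !big_ord0 addr0 divff ?gt_eqF// mulr1.
have mn0 : m + n.+1%:R != 0 by rewrite gt_eqF// addr_gt0.
rewrite big_ord_recl/= subr0 mulrA divfK// big_ord_recl/= addr0; congr (_ * _).
rewrite (reindex_inj rev_ord_inj)/=; apply: eq_bigr => i _.
rewrite /bump/= !add1n -addrA; congr (_ + _).
rewrite -natrB; last by rewrite ltnS leq_subr.
by rewrite subSS subKn.
Qed.

Theorem mainTheorem2 (R : realType) (m a b : R)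
    (m_gt0 : 0 < m) (a_gt0 : 0 < a) (b_gt0 : 0 < b) :
  forall x : nat, gnbbe_pmf m 1 a b 1 x = (waring_pmf m a b x)%:E.
Proof.
move=> x.
have ax0 : 0 < a + x%:R by rewrite ltr_wpDr.
have mb0 : 0 < m + b by rewrite addr_gt0.
transitivity ((rising m x / x`!%:R / Beta a b)%:E
    * eBeta_exp (a + x%:R) (m + b))%E.
  rewrite [RHS]muleC /eBeta_exp -ge0_integralZr//.
  - apply: eq_integral => l; rewrite inE/= => l_itv.
    move: (l_itv); rewrite in_itv/= andbT => l0.
    have w0 : 0 < 1 - expR (- l) by rewrite subr_gt0 expR_lt1 oppr_lt0.
    rewrite /gnb_pmf gnb_coef1// /be_pdf patchE mem_set// -EFinM.
    rewrite !mul1r mulr1 addrK; congr EFin.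
    have -> : expR (- l) `^ m = expR (- (m * l)).
      by rewrite /powR gt_eqF ?expR_gt0// expRK mulrN.
    have -> : expR (- ((m + b) * l)) = expR (- (m * l)) * expR (- (b * l)).
      by rewrite -expRD; congr expR; ring.
    have -> : (1 - expR (- l)) `^ (a + x%:R - 1) =
        (1 - expR (- l)) `^ (a - 1) * (1 - expR (- l)) ^+ x.
      rewrite -powR_mulrn ?(ltW w0)// -powRD ?(gt_eqF w0) ?implybT//.
      by congr (_ `^ _); ring.
    ring.
  - apply/measurable_EFinP/measurable_funTS.
    exact: measurable_eBeta_exp_integrand.
  - by move=> l _; rewrite lee_fin mulr_ge0 ?powR_ge0 ?expR_ge0.
  - rewrite lee_fin /Beta /rising.
    by rewrite !(divr_ge0, mulr_ge0)// ltW// Gamma_gt0// ltr_wpDr// ltW.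
rewrite eBeta_expE// -EFinM; congr EFin.
have -> : Beta (a + x%:R) (m + b)
    = Gamma (a + x%:R) * Gamma (m + b) / Gamma (m + a + b + x%:R).
  by rewrite /Beta; congr (_ / Gamma _); ring.
rewrite /waring_pmf /Beta /rising.
have Ga : Gamma a != 0 by rewrite gt_eqF// Gamma_gt0.
have Gb : Gamma b != 0 by rewrite gt_eqF// Gamma_gt0.
have Gm : Gamma m != 0 by rewrite gt_eqF// Gamma_gt0.
have Gab : Gamma (a + b) != 0 by rewrite gt_eqF// Gamma_gt0// addr_gt0.
have Gmab : Gamma (m + a + b) != 0 by rewrite gt_eqF// Gamma_gt0// !addr_gt0.
have Gmabx : Gamma (m + a + b + x%:R) != 0.
  by rewrite gt_eqF// Gamma_gt0// ltr_wpDr// !addr_gt0.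
have x0 : x`!%:R != 0 :> R by rewrite pnatr_eq0 -lt0n fact_gt0.
(* The Gamma values and the factorial become variables: the field
   normalization would otherwise try to compute with them. *)
move: (Gamma (m + a + b + x%:R)) (Gamma (m + a + b)) (Gamma (a + b))
  (Gamma (m + b)) (Gamma (m + x%:R)) (Gamma (a + x%:R))
  (Gamma m) (Gamma a) (Gamma b) (x`!%:R : R) Ga Gb Gm Gab Gmab Gmabx x0.
move=> ? ? ? ? ? ? ? ? ? ? Ga Gb Gm Gab Gmab Gmabx x0.
by field; rewrite Ga Gb Gm Gab Gmab Gmabx x0.
Qed.
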